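(* Let $m\ge 1$ and $1\le i\le m$. For all sufficiently large positive integers $q$, the number of points $(x_1,\dots,x_m)\in\mathbb{Z}_q^m$ with $x_i=1$ that lie on no hyperplane $H'_q$ with $H'\in\mathcal{B}_m\setminus\{\{x_i=1\}\}$ equals $$(q-2m)^{i-1}(q-2m+1)^{m-i}.$$ That is, $|M((\mathcal{B}_m^{\{x_i=1\}})_q)|=(q-2m)^{i-1}(q-2m+1)^{m-i}$.
   Context: For $m\ge1$, the Shi arrangement of type B is the set of affine hyperplanes in $\mathbb{R}^m$ $$\mathcal{B}_m=\{\{x_s=0\},\{x_s=1\}\mid s\in[m]\}\cup\{\{x_s\pm x_t=0\},\{x_s\pm x_t=1\}\mid 1\le s<t\le m\},$$ where $[m]=\{1,\dots,m\}$. For a positive integer $q$ and a hyperplane $H=\{a_1x_1+\dots+a_mx_m=b\}$ with integer coefficients, $H_q=\{x\in\mathbb{Z}_q^m : [a_1]_qx_1+\dots+[a_m]_qx_m=[b]_q\}$ is its reduction modulo $q$, with $\mathbb{Z}_q=\mathbb{Z}/q\mathbb{Z}$. For $H\in\mathcal{B}_m$, the restriction is $\mathcal{B}_m^H=\{H\cap H' : H'\in\mathcal{B}_m\setminus\{H\},\ H\cap H'\neq\emptyset\}$, and $|M((\mathcal{B}_m^H)_q)|$ denotes the number of points of $H_q$ not lying on any $H'_q$ with $H'\in\mathcal{B}_m\setminus\{H\}$ (the characteristic quasi-polynomial of the restriction). *)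

(* Defs.v *)
From mathcomp Require Import all_boot all_order all_algebra.
From mathcomp Require Import boolp classical_sets reals.

Set Implicit Arguments.
Unset Strict Implicit.
Unset Printing Implicit Defensive.
Import Order.TTheory GRing.Theory Num.Theory.
Local Open Scope classical_set_scope.
Local Open Scope ring_scope.

(* The reduction modulo q depends on the chosen integral equation and not only
   on the real hyperplane (2x = 0 and x = 0 differ modulo 2), so an arrangement
   is given by the equations (a, b), standing for a_1 x_1 + ... + a_m x_m = b. *)
Definition equation (m : nat) : Type := ('rV[int]_m * int)%type.

Definition hyperplane (R : realType) (m : nat) (e : equation m) :
    set 'rV[R]_m :=
  [set x : 'rV[R]_m | \sum_(j < m) (e.1 0 j)%:~R * x 0 j = e.2%:~R].
Arguments hyperplane R {m} e.

(* 'Z_q is the ring Z/qZ only for 2 <= q. *)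
Definition reduction (q m : nat) (e : equation m) : set 'rV['Z_q]_m :=
  [set x : 'rV['Z_q]_m | \sum_(j < m) (e.1 0 j)%:~R * x 0 j = e.2%:~R].
Arguments reduction q {m} e.

Definition xvar (m : nat) (s : 'I_m) : 'rV[int]_m := delta_mx 0 s.

Definition shiB (m : nat) : set (equation m) :=
  [set e : equation m | exists (s : 'I_m) (b : int),
     (b = 0 \/ b = 1) /\ e = (xvar s, b)]
  `|`
  [set e : equation m | exists (s t : 'I_m) (b : int),
     [/\ (s < t)%N, b = 0 \/ b = 1
       & e = (xvar s + xvar t, b) \/ e = (xvar s - xvar t, b)]].
Arguments shiB m : clear implicits.

(* M((A^H)_q), where H is the hyperplane of e: removing H from A is done on
   hyperplanes of R^m, not on equations. *)
Definition restriction_complement (R : realType) (q m : nat)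
    (A : set (equation m)) (e : equation m) : set 'rV['Z_q]_m :=
  [set x : 'rV['Z_q]_m | reduction q e x /\
     forall e' : equation m, A e' -> hyperplane R e' <> hyperplane R e ->
       ~ reduction q e' x].
Arguments restriction_complement R q {m} A e.

(* Main.v *)
(* Fold the circle Z_q at 0: a point with no zero coordinate places m labels at
   distances 1, 2, ... from 0, each with a sign. Order the signed labels as
   1 < 2 < ... < m < -m < ... < -1. The point avoids the hyperplanes
   x_s +- x_t = 0, 1 exactly when the distances are distinct and every run of
   consecutive occupied distances carries increasing signed labels. Deleting the
   labels turns such a point into a free choice of (gap, sign) for each label:
   the labels falling in one gap can only be reinserted in increasing order.
   A label has at most m - 1 others before it, each taking up two points of the
   circle (one on either side of 0), so the q - 1 nonzero residues become
   q - 1 - 2 (m - 1) choices. The label i comes first, with sign +, exactly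
   when i chooses (gap 0, +) and no s < i makes that choice. *)
Require Import Defs.
From mathcomp Require Import all_boot all_order all_algebra.
From mathcomp Require Import boolp classical_sets reals.
From mathcomp Require Import zify lra.
Set Implicit Arguments.
Unset Strict Implicit.
Unset Printing Implicit Defensive.

(** * Words of signed labels and their order *)

Local Open Scope nat_scope.

(* A letter w codes the distance w./2 + 1 from 0 and the sign (-1)^w, so that
   the letters below q - 1 code the nonzero residues modulo q for both parities
   of q; when q is even, q/2 is coded with sign +. *)
Definition word_key (m : nat) (w : 'I_m -> nat) (s : 'I_m) : nat :=
  if odd (w s) then 2 * m - s else s.

(** [word_key] realises the order 1 < ... < m < -m < ... < -1. Labels are compared by gap, then by
    this order within a gap. *)
Definition word_lt (m : nat) (w : 'I_m -> nat) (t s : 'I_m) : bool :=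
  ((w t)./2 < (w s)./2) ||
  (((w t)./2 == (w s)./2) && (word_key w t < word_key w s)).

Definition word_rank (m : nat) (w : 'I_m -> nat) (s : 'I_m) : nat :=
  #|[pred t | word_lt w t s]|.

(** Here [w] gives each label a gap and a sign. A label moves outwards by one distance, hence two
    letters, for each label before it. *)
Definition spread (m : nat) (w : 'I_m -> nat) (s : 'I_m) : nat :=
  w s + (word_rank w s).*2.

Definition occupied (m : nat) (w : 'I_m -> nat) (j : nat) : nat :=
  #|[pred t | (w t)./2 < j]|.

(* Subtracting twice the number of labels keeps the sign. *)
Definition squeeze (m : nat) (w : 'I_m -> nat) (s : 'I_m) : nat :=
  w s - (occupied w (w s)./2).*2.

(** Only adjacent distances are compared; whole runs follow by induction in [run_key_lt]. *)
Definition valid_word (m : nat) (w : 'I_m -> nat) : Prop :=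
  (forall s t, (w s)./2 = (w t)./2 -> s = t) /\
  (forall s t, (w t)./2 = (w s)./2.+1 -> word_key w s < word_key w t).

Lemma word_key_inj (m : nat) (w : 'I_m -> nat) : injective (word_key w).
Proof.
move=> s t; rewrite /word_key => E; apply/val_inj => /=.
have := ltn_ord s; have := ltn_ord t; move: E.
by case: (odd (w s)); case: (odd (w t)); lia.
Qed.

Lemma word_lt_irr (m : nat) (w : 'I_m -> nat) : irreflexive (word_lt w).
Proof. by move=> s; rewrite /word_lt !ltnn eqxx. Qed.

Lemma word_lt_trans (m : nat) (w : 'I_m -> nat) : transitive (word_lt w).
Proof. by move=> s t u; rewrite /word_lt; lia. Qed.

Lemma word_lt_total (m : nat) (w : 'I_m -> nat) (s t : 'I_m) :
  s != t -> word_lt w s t || word_lt w t s.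
Proof.
move=> st; have : word_key w s != word_key w t.
  by apply: contra_neq st; apply: word_key_inj.
by rewrite /word_lt; lia.
Qed.

(** In one gap every + key lies below every - key, and the + letter is the smaller one. So the last
    label carries the largest letter, whatever the parity of the bound on letters. *)
Lemma word_lt_leq (m : nat) (w : 'I_m -> nat) (s t : 'I_m) :
  word_lt w s t -> w s <= w t.
Proof.
have := odd_double_half (w s); have := odd_double_half (w t).
have := ltn_ord s; have := ltn_ord t.
by rewrite /word_lt /word_key; case: (odd (w s)); case: (odd (w t)); lia.
Qed.

Lemma word_rank_lt (m : nat) (w : 'I_m -> nat) (t s : 'I_m) :
  word_lt w t s -> word_rank w t < word_rank w s.
Proof.
move=> ts; apply/proper_card/properP; split.
  by apply/fintype.subsetP => u; rewrite !inE => /word_lt_trans; apply.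
by exists t; rewrite inE // word_lt_irr.
Qed.

Lemma word_rank_max (m : nat) (w : 'I_m -> nat) (s : 'I_m) :
  word_rank w s <= m.-1.
Proof.
rewrite -[X in _ <= X.-1]card_ord -(cardC1 s); apply/subset_leq_card.
apply/fintype.subsetP => u; rewrite !inE; apply: contraL => /eqP ->.
by rewrite word_lt_irr.
Qed.

(** * Reinserting the labels *)

Lemma half_spread (m : nat) (w : 'I_m -> nat) (s : 'I_m) :
  (spread w s)./2 = (w s)./2 + word_rank w s.
Proof. by rewrite /spread halfD odd_double andbF doubleK. Qed.

Lemma word_key_spread (m : nat) (w : 'I_m -> nat) (s : 'I_m) :
  word_key (spread w) s = word_key w s.
Proof. by rewrite /word_key /spread oddD odd_double addbF. Qed.

(** Along the order the gap grows weakly and the rank strictly, so distances grow strictly; totality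
    gives the converse. *)
Lemma spread_lt (m : nat) (w : 'I_m -> nat) (t s : 'I_m) :
  ((spread w t)./2 < (spread w s)./2) = word_lt w t s.
Proof.
have lt_spread a b : word_lt w a b -> (spread w a)./2 < (spread w b)./2.
  move=> ab; have := word_rank_lt ab; move: ab; rewrite !half_spread /word_lt.
  by lia.
apply/idP/idP => [ts|/lt_spread //].
have /(word_lt_total w)/orP[//|/lt_spread st] : t != s.
  by apply: contraTneq ts => ->; rewrite ltnn.
by move: ts; rewrite ltnNge (ltnW st).
Qed.

(** Labels at adjacent distances have different ranks, so they come from the same gap, where keys
    decide the order. *)
Lemma spread_valid (m : nat) (w : 'I_m -> nat) : valid_word (spread w).
Proof.
split=> s t.
  move=> E; have [//|/word_lt_total -/(_ w)] := eqVneq s t.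
  by rewrite -!spread_lt E ltnn.
rewrite !word_key_spread => E.
have st : word_lt w s t by rewrite -spread_lt E.
have := word_rank_lt st; move: E st; rewrite !half_spread /word_lt; lia.
Qed.

Lemma spreadK (m : nat) (w : 'I_m -> nat) : squeeze (spread w) =1 w.
Proof.
move=> s; rewrite /squeeze.
have -> : occupied (spread w) (spread w s)./2 = word_rank w s.
  by apply: eq_card => t; rewrite !inE spread_lt.
by rewrite /spread addnK.
Qed.

(** * Deleting the labels *)

Lemma occupiedS (m : nat) (w : 'I_m -> nat) (j : nat) :
  valid_word w ->
  occupied w j.+1 = occupied w j + [exists s, (w s)./2 == j].
Proof.
case=> w_inj _; case: existsP => [[s /eqP sj]|no_s] /=.
  rewrite /occupied (cardD1 s) !inE sj ltnSn addnC; congr (_ + _).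
  apply: eq_card => t; rewrite !inE ltnS (leq_eqVlt (w t)./2).
  have [->|ts] := eqVneq t s; first by rewrite sj ltnn.
  have [|//] := eqVneq (w t)./2 j.
  by rewrite -sj => /w_inj/eqP; rewrite (negPf ts).
rewrite addn0; apply: eq_card => t; rewrite !inE ltnS leq_eqVlt.
by case: eqP => // tj; case: no_s; exists t; apply/eqP.
Qed.

Lemma occupied_leq (m : nat) (w : 'I_m -> nat) (j : nat) :
  valid_word w -> occupied w j <= j.
Proof.
move=> wv; elim: j => [|j IH]; first by rewrite /occupied eq_card0.
by rewrite occupiedS //; case: [exists _, _] => /=; lia.
Qed.

(** In a valid word, [j - occupied w j] is the number of empty places among the first [j]
    distances. *)
Lemma empty_mono (m : nat) (w : 'I_m -> nat) (j d : nat) :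
  valid_word w -> j - occupied w j <= j + d - occupied w (j + d).
Proof.
move=> wv; elim: d => [|d IH]; first by rewrite addn0.
apply: leq_trans IH _; have := occupied_leq (j + d) wv.
by rewrite addnS occupiedS //; case: [exists _, _] => /=; lia.
Qed.

(** No empty distance separates the two labels, so they share a run, along which the condition on
    neighbours chains. *)
Lemma run_key_lt (m : nat) (w : 'I_m -> nat) (d : nat) (t s : 'I_m) :
  valid_word w -> (w s)./2 = (w t)./2 + d.+1 ->
  (w s)./2 - occupied w (w s)./2 = (w t)./2 - occupied w (w t)./2 ->
  word_key w t < word_key w s.
Proof.
move=> wv; elim: d s => [|d IH] s Es Ee.
  by apply: wv.2; rewrite Es addn1.
have Es' : (w s)./2 = ((w t)./2 + d.+1).+1 by rewrite Es addnS.
have := empty_mono (w t)./2 d.+1 wv; have := occupied_leq ((w t)./2 + d.+1) wv.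
move: (Ee); rewrite Es' occupiedS //.
(* An empty distance just below [s] would raise the number of empty places, against [Ee]. *)
case: existsP => [[u /eqP uj]|_] /=; last by lia.
move=> E1 E2 E3; apply: (@ltn_trans (word_key w u)); last by apply: wv.2; rewrite uj.
by apply: IH => //; rewrite uj; lia.
Qed.

Lemma half_squeeze (m : nat) (w : 'I_m -> nat) (s : 'I_m) :
  (squeeze w s)./2 = (w s)./2 - occupied w (w s)./2.
Proof.
by rewrite /squeeze; have := odd_double_half (w s); lia.
Qed.

Lemma word_key_squeeze (m : nat) (w : 'I_m -> nat) (s : 'I_m) :
  valid_word w -> word_key (squeeze w) s = word_key w s.
Proof.
(* The subtraction in [squeeze] does not truncate, so parity survives. *)
move=> /occupied_leq -/(_ (w s)./2) le_s.
rewrite /word_key /squeeze oddB ?odd_double ?addbF //.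
by have := odd_double_half (w s); lia.
Qed.

(** The number of empty places below a label grows weakly with its distance. In a tie the two labels
    share a run, where keys increase. *)
Lemma squeeze_lt (m : nat) (w : 'I_m -> nat) (t s : 'I_m) :
  valid_word w -> word_lt (squeeze w) t s = ((w t)./2 < (w s)./2).
Proof.
move=> wv.
have lt_squeeze a b : (w a)./2 < (w b)./2 -> word_lt (squeeze w) a b.
  move=> ab; rewrite /word_lt !word_key_squeeze // !half_squeeze.
  have /run_key_lt -/(_ wv) : (w b)./2 = (w a)./2 + ((w b)./2 - (w a)./2).-1.+1 by lia.
  have := empty_mono (w a)./2 ((w b)./2 - (w a)./2) wv.
  rewrite subnKC ?(ltnW ab) // leq_eqVlt => /orP[/eqP E run|-> //].
  by rewrite E ltnn eqxx /= run.
apply/idP/idP => [ts|/lt_squeeze //].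
rewrite ltnNge leq_eqVlt; apply/negP => /orP[/eqP/wv.1 E|/lt_squeeze st].
  by rewrite E word_lt_irr in ts.
by have := word_lt_trans st ts; rewrite word_lt_irr.
Qed.

Lemma squeezeK (m : nat) (w : 'I_m -> nat) :
  valid_word w -> spread (squeeze w) =1 w.
Proof.
move=> wv s; rewrite /spread.
have -> : word_rank (squeeze w) s = occupied w (w s)./2.
  by apply: eq_card => t; rewrite !inE squeeze_lt.
rewrite /squeeze subnK //.
by have := odd_double_half (w s); have := occupied_leq (w s)./2 wv; lia.
Qed.

(** * Range of the letters, and the letter 0 *)

Lemma spread_bound (m n : nat) (w : 'I_m -> nat) :
  (forall s, w s < n) -> forall s, spread w s < n + (m.-1).*2.
Proof.
by move=> wn s; rewrite /spread; have := wn s; have := word_rank_max w s; lia.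
Qed.

(** The farthest label [M] has rank m - 1 after squeezing, so it loses exactly 2 (m - 1). By
    [word_lt_leq] its letter bounds all the others. *)
Lemma squeeze_bound (m n : nat) (w : 'I_m -> nat) :
  valid_word w -> (forall s, w s < n + (m.-1).*2) ->
  forall s, squeeze w s < n.
Proof.
move=> wv wn s.
pose M := [arg max_(t > s) (w t)./2].
have maxM t : (w t)./2 <= (w M)./2 by rewrite /M; case: arg_maxnP => // u _; apply.
have M_top t : t != M -> word_lt (squeeze w) t M.
  move=> tM; rewrite squeeze_lt // ltn_neqAle maxM andbT.
  by apply: contra_neq tM => /wv.1.
have rankM : word_rank (squeeze w) M = m.-1.
  rewrite -[X in X.-1]card_ord -(cardC1 M); apply: eq_card => t; rewrite !inE.
  by have [->|/M_top] := eqVneq t M; rewrite ?word_lt_irr.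
have sM : squeeze w s <= squeeze w M.
  by have [->//|/M_top/word_lt_leq] := eqVneq s M.
apply: leq_ltn_trans sM _.
by have := wn M; rewrite -(squeezeK wv) /spread rankM ltn_add2r.
Qed.

Lemma spread_eq0 (m : nat) (w : 'I_m -> nat) (i : 'I_m) :
  (spread w i == 0) = (w i == 0) && [forall s : 'I_m, (s < i) ==> (w s != 0)].
Proof.
rewrite /spread addn_eq0 double_eq0; case: eqP => //= wi0.
(* A label with sign - in gap 0 has a larger key than [i], so only + labels of smaller index precede
   it. *)
have low s : word_lt w s i = (s < i) && (w s == 0).
  rewrite /word_lt /word_key wi0 /=; have := odd_double_half (w s).
  have := ltn_ord s; have := ltn_ord i.
  by case: (odd (w s)); lia.
apply/eqP/forallP => [/card0_eq r0 s|nz].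
  by apply/implyP => si; have := r0 s; rewrite inE low si /= => ->.
apply: eq_card0 => s; rewrite inE low.
by have := nz s; case: (s < i) => //= /negPf.
Qed.

(** * Nonzero residues as letters *)

Import Order.TTheory GRing.Theory Num.Theory.
Local Open Scope ring_scope.

Definition word_int (w : nat) : int :=
  if odd w then - (w./2.+1)%:Z else (w./2.+1)%:Z.

Lemma intr_Zp_eq0 (q : nat) (k : int) :
  (1 < q)%N -> ((k%:~R : 'Z_q) == 0) = (q %| `|k|)%N.
Proof.
move=> q1; have natE n : ((n%:R : 'Z_q) == 0) = (q %| n)%N.
  by rewrite -(inj_eq val_inj) /= val_Zp_nat.
case: k => n; first by rewrite -pmulrn natE.
by rewrite NegzE mulrNz oppr_eq0 -pmulrn natE abszN.
Qed.

(** Letters stand for integers of absolute value at most q/2, so this range covers their sums and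
    differences shifted by 1 and leaves linear arithmetic. *)
Lemma intr_Zp_small (q : nat) (k : int) :
  (1 < q)%N -> (`|k| < q.*2)%N ->
  ((k%:~R : 'Z_q) == 0) = [|| k == 0, k == q%:Z | k == - q%:Z].
Proof.
move=> q1 kq; rewrite intr_Zp_eq0 //; apply/idP/idP => [/dvdnP[[|[|c]] E]|]; try lia.
by case/or3P => /eqP ->; rewrite ?abszN ?dvdn0 ?dvdnn.
Qed.

Lemma word_int_neq0 (q w : nat) :
  (1 < q)%N -> (w < q.-1)%N -> ((word_int w)%:~R : 'Z_q) != 0.
Proof.
move=> q1 wq; have := odd_double_half w.
by rewrite /word_int intr_Zp_small //; case: (odd w); lia.
Qed.

Lemma word_int_inj (q a b : nat) :
  (1 < q)%N -> (a < q.-1)%N -> (b < q.-1)%N ->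
  (word_int a)%:~R = (word_int b)%:~R :> 'Z_q -> a = b.
Proof.
move=> q1 aq bq /eqP; rewrite -subr_eq0 -rmorphB /=.
have := odd_double_half a; have := odd_double_half b.
by rewrite /word_int intr_Zp_small //; case: (odd a); case: (odd b); lia.
Qed.

Lemma word_int_surj (q : nat) (x : 'Z_q) :
  (1 < q)%N -> x != 0 ->
  exists2 w : nat, (w < q.-1)%N & (word_int w)%:~R = x.
Proof.
move=> q1 x0; have xq : (x < q)%N by rewrite -[X in (_ < X)%N](Zp_cast q1) ltn_ord.
have x_gt0 : (0 < x)%N by rewrite lt0n; apply: contra_neq x0 => E; apply/val_inj.
(* A residue up to q/2 inclusive is a distance with sign +; a larger one is minus the distance q -
   x. *)
have [le|gt] := leqP x.*2 q.
  exists x.-1.*2; first by lia.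
  by rewrite /word_int odd_double doubleK prednK // -pmulrn natr_Zp.
exists (q - x).-1.*2.+1; first by lia.
rewrite /word_int /= odd_double /= uphalf_double prednK ?subn_gt0 // rmorphN /=.
by rewrite -pmulrn natrB ?(ltnW xq) // pchar_Zp // sub0r opprK natr_Zp.
Qed.

(** If [b] is one step farther out than [a], one of [x + y], [x - y] is 1 exactly when [x] has sign
    -, whatever the sign of [y]. If [a] is one step farther, this happens exactly when [x] has sign
    +. Wrapping around modulo q adds no case, as q/2 only occurs with sign +. *)
Lemma word_int_shi (q a b : nat) :
  (3 < q)%N -> (a < q.-1)%N -> (b < q.-1)%N ->
  let x := (word_int a)%:~R : 'Z_q in let y := (word_int b)%:~R : 'Z_q in
  [&& x + y != 0, x + y != 1, x - y != 0 & x - y != 1] =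
  [&& a./2 != b./2, (b./2 == a./2.+1) ==> ~~ odd a
    & (a./2 == b./2.+1) ==> odd a].
Proof.
move=> q3 aq bq x y; have q1 : (1 < q)%N by lia.
rewrite -[x + y == 1]subr_eq0 -[x - y == 1]subr_eq0 -!(rmorphB, rmorphD) /=.
rewrite -[1](rmorph1 (intmul 1)) -!rmorphB /=.
have := odd_double_half a; have := odd_double_half b.
by rewrite /word_int !intr_Zp_small //; case: (odd a); case: (odd b); lia.
Qed.

(** * Hyperplanes as conditions on coordinates and letters *)

Lemma sum_xvar (T : nzRingType) (m : nat) (s : 'I_m) (x : 'rV[T]_m) :
  \sum_(j < m) (xvar s 0 j)%:~R * x 0 j = x 0 s.
Proof.
rewrite (bigD1 s) //= mxE !eqxx mul1r big1 ?addr0 // => j js.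
by rewrite mxE (negPf js) andbF mul0r.
Qed.

Lemma sum_xvarD (T : nzRingType) (m : nat) (s t : 'I_m) (x : 'rV[T]_m) :
  \sum_(j < m) ((xvar s + xvar t) 0 j)%:~R * x 0 j = x 0 s + x 0 t.
Proof.
rewrite -!sum_xvar -big_split; apply: eq_bigr => j _ /=.
by rewrite mxE rmorphD mulrDl.
Qed.

Lemma sum_xvarB (T : nzRingType) (m : nat) (s t : 'I_m) (x : 'rV[T]_m) :
  \sum_(j < m) ((xvar s - xvar t) 0 j)%:~R * x 0 j = x 0 s - x 0 t.
Proof.
rewrite -!sum_xvar -sumrB; apply: eq_bigr => j _ /=.
by rewrite !mxE rmorphB mulrBl.
Qed.

(** Removal is by real hyperplanes; this shows that it discards a single equation. Points with x_i =
    1 rule out every other one. *)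
Lemma hyperplane_xvar_inj (R : realType) (m : nat) (i : 'I_m) (e : equation m) :
  shiB m e -> hyperplane R e = hyperplane R (xvar i, 1) -> e = (xvar i, 1).
Proof.
move=> Ae eq_e.
have on_e (x : 'rV[R]_m) :
    x 0 i = 1 -> \sum_(j < m) (e.1 0 j)%:~R * x 0 j = e.2%:~R.
  move=> xi; suff : hyperplane R e x by [].
  by rewrite eq_e /hyperplane /= sum_xvar.
(* For [r] other than [i], the entry 7 keeps x_r, and its sum and differences with an entry 0 or 1,
   away from the values 0 and 1. *)
pose pt r : 'rV[R]_m := \row_j (if j == i then 1 else if j == r then 7 else 0).
have on_pt r : \sum_(j < m) (e.1 0 j)%:~R * pt r 0 j = e.2%:~R.
  by apply: on_e; rewrite mxE eqxx.
case: Ae => [[s [b [b01 E]]]|[s [t [b [st b01 E]]]]].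
  have := on_pt s; rewrite E /= sum_xvar mxE eqxx.
  by have [->|_] := eqVneq s i; case: b01 => -> // pt_on; exfalso; move: pt_on; clear; lra.
exfalso; have si_ti : s != i \/ t != i.
  by have [si|] := eqVneq s i; [right; rewrite -si eq_sym neq_ltn st|left].
have /negPf ts : t != s by rewrite neq_ltn st orbT.
have := on_pt s; have := on_pt t.
case: E => ->; rewrite /= ?sum_xvarD ?sum_xvarB !mxE !eqxx [s == t]eq_sym ts.
  by case: b01 => ->; case: eqP si_ti => _; case: eqP => _ [] //= _; clear; lra.
by case: b01 => ->; case: eqP si_ti => _; case: eqP => _ [] //= _; clear; lra.
Qed.

Lemma restriction_complementP (R : realType) (q m : nat) (i : 'I_m)
    (x : 'rV['Z_q]_m) : (1 < q)%N ->
  (x \in restriction_complement R q (shiB m) (xvar i, 1)) <->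
  [/\ x 0 i = 1, forall s, x 0 s != 0, forall s, s != i -> x 0 s != 1
    & forall s t : 'I_m, (s < t)%N ->
      [&& x 0 s + x 0 t != 0, x 0 s + x 0 t != 1,
          x 0 s - x 0 t != 0 & x 0 s - x 0 t != 1]].
Proof.
move=> q1; rewrite inE /restriction_complement /= /reduction /= sum_xvar.
split=> [[xi off]|[xi x0 x1 xst]].
  have offA e : shiB m e -> e <> (xvar i, 1) ->
      \sum_(j < m) (e.1 0 j)%:~R * x 0 j != e.2%:~R.
    move=> Ae ne; apply/eqP; apply: off => // /(hyperplane_xvar_inj Ae).
    exact: ne.
  have off1 (s : 'I_m) (b : int) : b = 0 \/ b = 1 -> (xvar s, b) <> (xvar i, 1) ->
      x 0 s != b%:~R.
    by move=> b01 /offA; rewrite sum_xvar; apply; left; exists s, b.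
  have off2 (s t : 'I_m) (b : int) : (s < t)%N -> b = 0 \/ b = 1 ->
      (x 0 s + x 0 t != b%:~R) && (x 0 s - x 0 t != b%:~R).
    move=> st b01.
    (* Two nonzero coefficients distinguish [v] from [xvar i]. *)
    have ne (v : 'rV[int]_m) : v 0 t != 0 -> v 0 s != 0 -> (v, b) <> (xvar i, 1).
      move=> vt vs [E _]; move: vt vs; rewrite E !mxE !eqxx /=.
      have [ti|_] := eqVneq t i; last by rewrite eqxx.
      have [si|_] := eqVneq s i; last by rewrite eqxx.
      by rewrite ti si ltnn in st.
    have [st' ts'] : (s == t) = false /\ (t == s) = false.
      by split; apply/negbTE; rewrite neq_ltn st ?orbT.
    apply/andP; split.
      rewrite -sum_xvarD; apply: (offA (_, _)).
        by right; exists s, t, b; split=> //; left.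
      by apply: ne; rewrite !mxE !eqxx ?st' ?ts'.
    rewrite -sum_xvarB; apply: (offA (_, _)).
      by right; exists s, t, b; split=> //; right.
    by apply: ne; rewrite !mxE !eqxx ?st' ?ts'.
  split=> //.
  - by move=> s; apply: (off1 s 0); [left|case].
  - move=> s si; apply: (off1 s 1); first by right.
    by case=> /matrixP/(_ 0 s)/eqP; rewrite !mxE !eqxx (negPf si).
  - move=> s t st; have /andP[-> ->] := off2 s t 0 st (or_introl erefl).
    by have /andP[-> ->] := off2 s t 1 st (or_intror erefl).
split=> // e [[s [b [b01 ->]]]|[s [t [b [st b01 E]]]]].
  rewrite sum_xvar; have [->|si _] := eqVneq s i.
    case: b01 => -> // _; rewrite xi; apply/eqP.
    by rewrite oner_eq0.
  by case: b01 => ->; apply/eqP; [exact: x0|exact: x1].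
move=> _; have /and4P[] := xst s t st.
case: E => -> /=; rewrite ?sum_xvarD ?sum_xvarB.
  by case: b01 => -> /eqP ? /eqP ?.
by case: b01 => -> _ _ /eqP ? /eqP ?.
Qed.

(** For [s < t], +s precedes and -s follows both t and -t, so only the sign of the smaller index
    matters, as in [word_int_shi]. *)
Lemma valid_wordP (m : nat) (w : 'I_m -> nat) :
  valid_word w <-> forall s t : 'I_m, (s < t)%N ->
    [&& (w s)./2 != (w t)./2, ((w t)./2 == (w s)./2.+1) ==> ~~ odd (w s)
      & ((w s)./2 == (w t)./2.+1) ==> odd (w s)].
Proof.
have key_lt (s t : 'I_m) : (s < t)%N ->
    (word_key w s < word_key w t)%N = ~~ odd (w s) /\
    (word_key w t < word_key w s)%N = odd (w s).
  have := ltn_ord s; have := ltn_ord t; rewrite /word_key.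
  by case: (odd (w s)); case: (odd (w t)) => /=; lia.
split=> [[w_inj run] s t st|wst].
  have [<- <-] := key_lt s t st; apply/and3P; split.
  - by apply: contraTneq st => /w_inj ->; rewrite ltnn.
  - by apply/implyP => /eqP/run.
  - by apply/implyP => /eqP/run.
split=> s t.
  move=> E; apply/val_inj => /=; case: (ltngtP s t) => // st.
    by have := wst s t st; rewrite E eqxx.
  by have := wst t s st; rewrite E eqxx.
move=> E; case: (ltngtP s t) => [st|ts|/val_inj st].
- by have [-> _] := key_lt s t st; have /and3P[_ /implyP->] := wst s t st; rewrite ?E.
- by have [_ ->] := key_lt t s ts; have /and3P[_ _ /implyP->] := wst t s ts; rewrite ?E.
- by move: E; rewrite st => /eqP; rewrite eqn_leq ltnn andbF.
Qed.

(** * The bijections and the count *)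

Definition ffun_word (m n : nat) (w : {ffun 'I_m -> 'I_n}) (s : 'I_m) : nat :=
  w s.

Definition shi_words (m n : nat) (i : 'I_m) : pred {ffun 'I_m -> 'I_n} :=
  [pred w | `[< valid_word (ffun_word w) >] && (ffun_word w i == 0%N)].

(** Independent choices of gap and sign: for n = q - 1 the range has q - 2m + 1 letters. The
    conditions at 0 are those of [spread_eq0]. *)
Definition free_letters (m n : nat) (i s : 'I_m) : pred 'I_n :=
  [pred c : 'I_n | ((c : nat) < n - m.-1.*2)%N &&
    (if (s < i)%N then (c : nat) != 0%N
     else if s == i then (c : nat) == 0%N else true)].

Lemma card_restriction_complement (R : realType) (q m : nat) (i : 'I_m) :
  (3 < q)%N ->
  #|restriction_complement R q (shiB m) (xvar i, 1)| = #|@shi_words m q.-1 i|.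
Proof.
move=> q3; have q1 : (1 < q)%N by lia.
pose x_of (w : {ffun 'I_m -> 'I_q.-1}) : 'rV['Z_q]_m :=
  \row_s (word_int (ffun_word w s))%:~R.
have x_of_inj : injective x_of.
  move=> u v /matrixP uv; apply/ffunP => s; apply/val_inj.
  by apply: (word_int_inj q1); rewrite ?ltn_ord //; have := uv 0 s; rewrite !mxE.
rewrite -(card_image x_of_inj); apply: eq_card => x.
have word1 (w : nat) : (w < q.-1)%N ->
    ((word_int w)%:~R == 1 :> 'Z_q) = (w == 0%N).
  move=> wq; have one : (word_int 0)%:~R = 1 :> 'Z_q by [].
  rewrite -one; apply/eqP/eqP => [|-> //]; apply: word_int_inj => //; lia.
apply/idP/fintype.imageP => [/(restriction_complementP _ _ _ q1)[xi x0 x1 xst]|[w]].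
  have wP s : exists c : 'I_q.-1, (word_int c)%:~R = x 0 s.
    by have [c cq <-] := word_int_surj q1 (x0 s); exists (Ordinal cq).
  have [w wE] := choice wP.
  have xE s : (word_int (ffun_word (finfun w) s))%:~R = x 0 s.
    by rewrite /ffun_word ffunE wE.
  exists (finfun w); last by apply/rowP => s; rewrite mxE xE.
  rewrite inE -word1 ?ltn_ord // xE xi eqxx andbT; apply/asboolP/valid_wordP.
  by move=> s t /xst; rewrite -!xE word_int_shi ?ltn_ord.
rewrite inE => /andP[/asboolP wv w0] ->; apply/(restriction_complementP _ _ _ q1).
split.
- by rewrite mxE; apply/eqP; rewrite word1 ?ltn_ord.
- by move=> s; rewrite mxE word_int_neq0 ?ltn_ord.
(* The value 1 is the letter 0, already taken by [i], and distances are distinct. *)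
- move=> s si; rewrite mxE word1 ?ltn_ord //; apply: contra_neq si => ws.
  by apply: wv.1; rewrite ws (eqP w0).
- by move=> s t st; rewrite !mxE word_int_shi ?ltn_ord //; exact: (iffLR (valid_wordP _) wv).
Qed.

Lemma card_shi_words (m n : nat) (i : 'I_m) :
  (m.-1.*2 <= n)%N -> #|@shi_words m n i| = #|family (@free_letters m n i)|.
Proof.
move=> mn.
(* The default of [insubd] is never reached: [spread_bound] covers [Sp] on free words, and squeezing
   only lowers letters. *)
pose Sp (u : {ffun 'I_m -> 'I_n}) : {ffun 'I_m -> 'I_n} :=
  [ffun s => insubd (u s) (spread (ffun_word u) s)].
pose Sq (u : {ffun 'I_m -> 'I_n}) : {ffun 'I_m -> 'I_n} :=
  [ffun s => insubd (u s) (squeeze (ffun_word u) s)].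
have letterP u : u \in family (@free_letters m n i) ->
    (forall s, ffun_word u s < n - m.-1.*2)%N /\ spread (ffun_word u) i = 0%N.
  move=> /familyP uF; split=> [s|]; first by have /andP[] := uF s.
  apply/eqP; rewrite spread_eq0; apply/andP; split.
    by have := uF i; rewrite inE ltnn eqxx => /andP[].
  by apply/forallP => s; apply/implyP => si; have := uF s; rewrite inE si => /andP[].
have SpE u : u \in family (@free_letters m n i) ->
    ffun_word (Sp u) = spread (ffun_word u).
  move=> /letterP[ulow _]; apply/funext => s.
  rewrite /ffun_word ffunE val_insubd.
  by have := spread_bound ulow s; rewrite subnK // => ->.
have SqE u : ffun_word (Sq u) = squeeze (ffun_word u).
  apply/funext => s; rewrite /ffun_word ffunE val_insubd.
  by rewrite (leq_ltn_trans (leq_subr _ _) (ltn_ord _)).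
have ffun_word_inj : injective (@ffun_word m n).
  by move=> u v uv; apply/ffunP => s; apply/val_inj; apply: (congr1 (@^~ s) uv).
have Sp_shi u : u \in family (@free_letters m n i) -> Sp u \in @shi_words m n i.
  move=> uF; rewrite inE SpE // (letterP _ uF).2 eqxx andbT; apply/asboolP.
  exact: spread_valid.
have Sq_free u : u \in @shi_words m n i -> Sq u \in family (@free_letters m n i).
  move=> uS; have := uS; rewrite inE => /andP[/asboolP uv /eqP ui].
  (* Spreading gives the valid word back, so its letter 0 at [i] becomes conditions on the squeezed
     letters. *)
  have := spread_eq0 (squeeze (ffun_word u)) i.
  rewrite squeezeK // ui eqxx => /esym/andP[/eqP ci /forallP cs].
  apply/familyP => s; have := cs s; rewrite inE.
  rewrite -[nat_of_ord (Sq u s)]/(ffun_word (Sq u) s) SqE => cs_s.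
  rewrite squeeze_bound //; last by move=> t; rewrite subnK ?ltn_ord.
  by case: ifP cs_s => //= _ _; case: eqP => // ->; rewrite ci.
have SpK : {in family (@free_letters m n i), cancel Sp Sq}.
  move=> u uF; apply: ffun_word_inj; rewrite SqE SpE //.
  by apply/funext; apply: spreadK.
have SqK : {in @shi_words m n i, cancel Sq Sp}.
  move=> u uS; apply: ffun_word_inj; rewrite SpE ?Sq_free // SqE.
  apply/funext; apply: squeezeK.
  by move: uS; rewrite inE => /andP[/asboolP].
rewrite -(card_in_image (can_in_inj SpK)); apply: eq_card => u.
apply/idP/fintype.imageP => [uS|[v vF ->]]; last exact: Sp_shi.
by exists (Sq u); [exact: Sq_free|rewrite SqK].
Qed.

Lemma card_ord_lt (n k : nat) : (k <= n)%N -> #|[pred c : 'I_n | (c < k)%N]| = k.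
Proof.
move=> kn; have widen_inj : injective (widen_ord kn).
  by move=> a b /(congr1 val) ab; apply/val_inj.
rewrite -[RHS]card_ord -(card_image widen_inj).
apply: eq_card => c; apply/idP/fintype.imageP => [|[d _ ->]]; rewrite inE //= => ck.
by exists (Ordinal ck) => //; apply/val_inj.
Qed.

Lemma card_free_letters (m n : nat) (i s : 'I_m) :
  (m.-1.*2 < n)%N ->
  #|@free_letters m n i s| =
  (if (s < i)%N then (n - m.-1.*2).-1 else if s == i then 1 else n - m.-1.*2)%N.
Proof.
move=> mn; have n0 : (0 < n)%N by lia.
have eq0 : (fun c : 'I_n => (c : nat) == 0%N) =1 pred1 (Ordinal n0).
  by move=> c; rewrite /= -val_eqE.
case: ifPn => si.
  have := card_ord_lt (leq_subr m.-1.*2 n).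
  rewrite (cardD1 (Ordinal n0)) inE /= subn_gt0 mn add1n => <-.
  apply: eq_card => c.
  by rewrite !inE si andbC -val_eqE.
case: ifPn => [/eqP ->|si'].
  rewrite -(card1 (Ordinal n0)); apply: eq_card => c.
  rewrite !inE ltnn eqxx -val_eqE /=; case: eqP => [->|_]; rewrite ?andbF //.
  by rewrite subn_gt0 mn.
rewrite -[RHS](card_ord_lt (leq_subr _ _)); apply: eq_card => c.
by rewrite !inE (negPf si) (negPf si') andbT.
Qed.

Lemma prod_ord_split (m a b : nat) (i : 'I_m) :
  (\prod_(s < m) (if s < i then a else if s == i then 1 else b) =
   a ^ i * b ^ (m - i.+1))%N.
Proof.
under eq_bigr => s _ do rewrite -val_eqE /=.
have im := ltn_ord i.
rewrite -(big_mkord xpredT (fun s => if s < i then a else if s == i then 1 else b)%N).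
rewrite (big_cat_nat (n := i)) //= ?(ltnW im) // (big_ltn im) ltnn eqxx mul1n.
congr (_ * _)%N.
  rewrite -[X in (_ = a ^ X)%N]subn0 -prod_nat_const_nat; apply: eq_big_nat => s.
  by move=> /andP[_ ->].
rewrite -prod_nat_const_nat; apply: eq_big_nat => s /andP[is_ _].
by rewrite ltnNge (ltnW is_) /= gtn_eqF.
Qed.

(* The ordinal i : 'I_m stands for the index i + 1 of [m] = {1, ..., m}. *)
Theorem theorem4p1 (R : realType) (m : nat) (hm : (1 <= m)%N) (i : 'I_m) :
  exists2 q0 : nat, (1 < q0)%N &
    forall q : nat, (q0 <= q)%N ->
      (#|restriction_complement R q (shiB m) (xvar i, 1)|)%:Z
      = (q%:Z - (2 * m)%:Z) ^+ i * (q%:Z - (2 * m)%:Z + 1) ^+ (m - i.+1).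
Proof.
(* This bound gives q > 3 and 2 (m - 1) < q - 1, and makes q - 2m a natural number. *)
exists (2 * m + 2)%N => [|q qm]; first by lia.
rewrite card_restriction_complement; last by lia.
rewrite card_shi_words; last by lia.
rewrite card_family foldrE big_map big_enum /=.
have mq : (m.-1.*2 < q.-1)%N by lia.
rewrite (eq_bigr _ (fun s _ => card_free_letters i s mq)).
have -> : q%:Z - (2 * m)%:Z = (q - 2 * m)%N%:Z by lia.
have -> : (q - 2 * m)%N%:Z + 1 = (q.-1 - m.-1.*2)%N%:Z by lia.
have -> : (q - 2 * m = (q.-1 - m.-1.*2).-1)%N by lia.
by rewrite prod_ord_split -natz natrM !natrX !natz.
Qed.
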